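(* For every integer $n \ge 1$, the $f$-vector of the canonical complex of the Tamari lattice $\mathrm{Tam}(n)$ on binary trees with $n$ nodes is $(a_{n,k})_{0 \le k < n}$, where $a_{n,k}$ denotes the number of intervals $S \le T$ of $\mathrm{Tam}(n)$ such that $\mathrm{des}(S) + \mathrm{asc}(T) = k$.
   Context: Tamari lattice. $\mathrm{Tam}(n)$ is the lattice whose elements are the (rooted, plane) binary trees with $n$ nodes, and whose cover relations are right rotations: $T'$ covers $T$ if $T'$ is obtained from $T$ by replacing a subtree of the form (node $j$ with left child $i$, where $i$ has subtrees $A,B$ and $j$ has right subtree $C$) by (node $i$ with left subtree $A$ and right child $j$, where $j$ has subtrees $B,C$). For a binary tree $T$, $\mathrm{des}(T)$ (resp. $\mathrm{asc}(T)$) is the number of binary trees covered by $T$ (resp. covering $T$) in $\mathrm{Tam}(n)$. The Tamari lattice is semidistributive. Canonical complex. A finite lattice $(L,\le,\wedge,\vee)$ is join semidistributive when $x \vee y = x \vee z$ implies $x \vee (y \wedge z) = x \vee y$; meet semidistributive is the dual notion; semidistributive means both. In a join semidistributive lattice, any $x$ admits a canonical join representation, which is the minimal irredundant representation $x = \bigvee J$, for the order $J \le J'$ if for any $j \in J$ there is $j' \in J'$ with $j \le j'$. The size of the canonical join representation of $x$ is the number of elements covered by $x$. Canonical meet representations are defined dually (with size the number of elements covering the given element). The canonical complex of a semidistributive lattice $L$ is the simplicial complex whose faces are the disjoint unions $J \sqcup M$ (join irreducibles and meet irreducibles being regarded as distinct vertices), where $x = \bigvee J$ is the canonical join representation of $x$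 and $y = \bigwedge M$ is the canonical meet representation of $y$, for some interval $x \le y$ in $L$. Convention. For the canonical complex, the ''dimension'' of the face $J \sqcup M$ is its number of elements $|J|+|M|$ (the empty face has index $0$), and the $f$-vector is $(f_0, f_1, \dots)$ where $f_i$ is the number of faces with $i$ elements. For example, for $n=3$ the $f$-vector is $(1,6,6)$. *)

(* Defs.v *)
From HB Require Import structures.
From mathcomp Require Import all_boot all_order.
From mathcomp Require Import zify.

Set Implicit Arguments.
Unset Strict Implicit.
Unset Printing Implicit Defensive.

Import Order.TTheory.

Section CanonicalComplex.
Local Open Scope order_scope.
Context {disp : Order.disp_t} {L : finTBLatticeType disp}.
Implicit Types (x y : L) (J M : {set L}).

Definition covers x y : bool := (y < x) && ~~ [exists z, (y < z) && (z < x)].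

Definition irredundant_join_rep J x : bool :=
  (\join_(j in J) j == x) &&
  [forall J' : {set L}, (J' \proper J) ==> (\join_(j in J') j != x)].

Definition join_refines J J' : bool :=
  [forall j in J, exists j' in J', j <= j'].

(* "Minimal" is read as "least", which makes the representation unique: mutual
   refinement of irredundant representations forces equality. *)
Definition canonical_join_rep J x : bool :=
  irredundant_join_rep J x &&
  [forall J' : {set L}, irredundant_join_rep J' x ==> join_refines J J'].

Definition irredundant_meet_rep M y : bool :=
  (\meet_(m in M) m == y) &&
  [forall M' : {set L}, (M' \proper M) ==> (\meet_(m in M') m != y)].

Definition meet_refines M M' : bool :=
  [forall m in M, exists m' in M', m' <= m].

Definition canonical_meet_rep M y : bool :=
  irredundant_meet_rep M y &&
  [forall M' : {set L}, irredundant_meet_rep M' y ==> meet_refines M M'].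

(* An element used as a join irreducible is tagged by [inl], one used as a
   meet irreducible by [inr]; members of canonical representations are
   automatically irreducible. *)
Definition disjoint_union J M : {set L + L} :=
  [set inl j | j in J] :|: [set inr m | m in M].

(* In a semidistributive lattice every element has exactly one canonical join
   representation and one canonical meet representation. *)
Definition canonical_complex : {set {set L + L}} :=
  [set F | [exists x : L, exists y : L, exists J : {set L}, exists M : {set L},
     [&& x <= y, canonical_join_rep J x, canonical_meet_rep M y
       & F == disjoint_union J M]]].

End CanonicalComplex.

Arguments canonical_complex {disp} L.

(* Faces are indexed by their number of elements, so entry [0] counts the empty
   face, and the last entry counts the faces of maximal cardinality. *)
Definition fvector (V : finType) (K : {set {set V}}) : seq nat :=
  mkseq (fun i => #|[set F in K | #|F| == i]|) (\max_(F in K) #|F|).+1.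

Inductive bintree := Leaf | Node of bintree & bintree.

Fixpoint nodes t := if t is Node l r then (nodes l + nodes r).+1 else 0.

Fixpoint bintree_encode t : GenTree.tree unit :=
  if t is Node l r
  then GenTree.Node 1 [:: bintree_encode l; bintree_encode r]
  else GenTree.Node 0 [::].

Fixpoint bintree_decode (g : GenTree.tree unit) : bintree :=
  if g is GenTree.Node 1 [:: l; r]
  then Node (bintree_decode l) (bintree_decode r) else Leaf.

Lemma bintree_encodeK : cancel bintree_encode bintree_decode.
Proof. by elim=> //= l -> r ->. Qed.

HB.instance Definition _ := Countable.copy bintree (can_type bintree_encodeK).

(* [rotation t t'] : [t'] is obtained from [t] by one right rotation. *)
Fixpoint rotation (t t' : bintree) : bool :=
  match t, t' with
  | Node l r, Node l' r' =>
      [|| if l is Node a b then (l' == a) && (r' == Node b r) else false,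
          rotation l l' && (r' == r)
        | (l' == l) && rotation r r']
  | _, _ => false
  end.

Variant rotation_spec : bintree -> bintree -> Prop :=
  | RotRoot a b c : rotation_spec (Node (Node a b) c) (Node a (Node b c))
  | RotLeft l l' r of rotation l l' : rotation_spec (Node l r) (Node l' r)
  | RotRight l r r' of rotation r r' : rotation_spec (Node l r) (Node l r').

Lemma rotationP t t' : rotation t t' -> rotation_spec t t'.
Proof.
case: t t' => [|l r] [|l' r'] //= /or3P[|/andP[h /eqP->]|/andP[/eqP-> h]].
- by case: l => // a b /andP[/eqP-> /eqP->]; constructor.
- exact: RotLeft.
- exact: RotRight.
Qed.

Lemma rotation_root a b c : rotation (Node (Node a b) c) (Node a (Node b c)).
Proof. by rewrite /= !eqxx. Qed.

Lemma rotation_left l l' r : rotation l l' -> rotation (Node l r) (Node l' r).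
Proof. by move=> /= ->; rewrite eqxx orbT. Qed.

Lemma rotation_right l r r' : rotation r r' -> rotation (Node l r) (Node l r').
Proof. by move=> /= ->; rewrite eqxx !orbT. Qed.

Lemma rotation_nodes t t' : rotation t t' -> nodes t' = nodes t.
Proof.
elim: t t' => [|l IHl r IHr] t' h; first by case: t' h.
move/rotationP: h => h; inversion_clear h as [a b c|? l' ? h'|? ? r' h'] => /=.
- lia.
- by rewrite (IHl _ h').
- by rewrite (IHr _ h').
Qed.

Inductive rotations (t : bintree) : bintree -> Prop :=
  | rotations_refl : rotations t t
  | rotations_step u v of rotations t u & rotation u v : rotations t v.

Lemma rotations_trans t u v : rotations t u -> rotations u v -> rotations t v.
Proof. by move=> tu; elim=> // v' w _ tv' vw; exact: rotations_step tv' vw. Qed.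

Lemma rotations_Node l l' r r' :
  rotations l l' -> rotations r r' -> rotations (Node l r) (Node l' r').
Proof.
move=> ll rr; apply: (@rotations_trans _ (Node l' r)).
  elim: ll => [|u v _ lu uv]; first exact: rotations_refl.
  by apply: rotations_step lu _; exact: rotation_left.
elim: rr => [|u v _ lu uv]; first exact: rotations_refl.
by apply: rotations_step lu _; exact: rotation_right.
Qed.

Lemma rotations_nodes t t' : rotations t t' -> nodes t' = nodes t.
Proof. by elim=> // u v _ <- /rotation_nodes. Qed.

(* The numbers of nodes of the right subtrees, listed in infix order. *)
Fixpoint bracket t : seq nat :=
  if t is Node l r then bracket l ++ nodes r :: bracket r else [::].

Lemma size_bracket t : size (bracket t) = nodes t.
Proof. by elim: t => //= l IHl r IHr; rewrite size_cat /= IHl IHr; lia. Qed.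

Definition is_bracket (v : seq nat) : Prop :=
  forall i, i < size v -> i + nth 0 v i < size v /\
    forall j, i < j <= i + nth 0 v i -> j + nth 0 v j <= i + nth 0 v i.

Lemma nth_bracket_Node l r i :
  nth 0 (bracket (Node l r)) i =
  if i < nodes l then nth 0 (bracket l) i
  else if i == nodes l then nodes r
  else nth 0 (bracket r) (i - (nodes l).+1).
Proof.
rewrite /= nth_cat size_bracket; case: ltnP => // li.
case: eqVneq => [->|ne]; first by rewrite subnn.
by have ->: i - nodes l = (i - (nodes l).+1).+1 by lia.
Qed.

Lemma bracketP t : is_bracket (bracket t).
Proof.
elim: t => [|l IHl r IHr] i; first by [].
rewrite size_bracket => lti; move: IHl IHr; rewrite /is_bracket !size_bracket.
move=> IHl IHr; rewrite nth_bracket_Node [nodes (Node _ _)]/=.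
case: (ltnP i (nodes l)) => [il|li].
  have [h1 h2] := IHl i il; split; first by lia.
  move=> j ij; have := h2 j ij; rewrite nth_bracket_Node.
  by have ->: j < nodes l by lia.
case: eqVneq => [->|ne].
  split; first by lia.
  move=> j jr; rewrite nth_bracket_Node.
  have -> : (j < nodes l) = false by lia.
  have -> : (j == nodes l) = false by lia.
  by have [] := IHr (j - (nodes l).+1); lia.
have ir : i - (nodes l).+1 < nodes r by move: lti => /=; lia.
have [h1 h2] := IHr _ ir; split; first by lia.
move=> j ij; rewrite nth_bracket_Node.
have -> : (j < nodes l) = false by lia.
have -> : (j == nodes l) = false by lia.
by have := h2 (j - (nodes l).+1); lia.
Qed.

Lemma is_bracketP v : is_bracket v -> exists t, bracket t = v.
Proof.
have [n] := ubnP (size v); elim: n v => // n IHn v ltvn vP.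
case: (posnP (size v)) => [/size0nil->|v_gt0]; first by exists Leaf.
have exi : exists i, (i < size v) && (i + nth 0 v i == (size v).-1).
  by exists (size v).-1; have := vP (size v).-1; lia.
case: (ex_minnP exi) => i /andP[iv /eqP Ei] imin.
have vE : v = take i v ++ nth 0 v i :: drop i.+1 v.
  by rewrite -drop_nth // cat_take_drop.
have st : size (take i v) = i by rewrite size_take iv.
have sd : size (drop i.+1 v) = nth 0 v i by rewrite size_drop; lia.
have [||l lE] := IHn (take i v); first by rewrite st; lia.
  move=> k; rewrite st => ki; rewrite nth_take //.
  have [|h1 h2] := vP k; first lia.
  have h3 : k + nth 0 v k < i.
    rewrite ltnNge; apply/negP => ik.
    have := h2 i; have := imin k; lia.
  by split=> // j jk; rewrite nth_take; [exact: h2 | lia].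
have [||r rE] := IHn (drop i.+1 v); first by rewrite sd; lia.
  move=> k; rewrite sd => ki; rewrite nth_drop.
  have [|h1 h2] := vP (i.+1 + k); first lia.
  split; first lia.
  by move=> j jk; rewrite nth_drop; have := h2 (i.+1 + j); lia.
by exists (Node l r); rewrite /= lE rE -size_bracket rE sd -vE.
Qed.

Definition leq_vec (u v : seq nat) : bool := all2 leq u v.

Lemma leq_vecP u v : size u = size v ->
  reflect (forall i, i < size u -> nth 0 u i <= nth 0 v i) (leq_vec u v).
Proof.
rewrite /leq_vec; elim: u v => [|x u IH] [|y v] //=; first by left.
move=> [/IH uv]; apply: (iffP andP) => [[xy /uv h] [|i] //|h].
  exact: h.
by split; [exact: (h 0)|apply/uv => i; exact: (h i.+1)].
Qed.

Lemma leq_vec_refl : reflexive leq_vec.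
Proof. by move=> v; apply/leq_vecP. Qed.

Lemma leq_vec_cat u u' v v' : size u = size v ->
  leq_vec (u ++ u') (v ++ v') = leq_vec u v && leq_vec u' v'.
Proof.
by rewrite /leq_vec; elim: u v => [|x u IH] [|y v] //= [/IH->]; rewrite andbA.
Qed.

Lemma leq_vec_cons x y u v :
  leq_vec (x :: u) (y :: v) = (x <= y) && leq_vec u v.
Proof. by []. Qed.

Lemma leq_vec_trans : transitive leq_vec.
Proof.
rewrite /leq_vec => v u w; elim: v u w => [|x v IH] [|y u] [|z w] //=.
move=> /andP[a b] /andP[c d]; rewrite (leq_trans a c); exact: IH b d.
Qed.

Lemma rotation_bracket t t' : rotation t t' ->
  leq_vec (bracket t) (bracket t') /\ sumn (bracket t) < sumn (bracket t').
Proof.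
elim: t t' => [|l IHl r IHr] t' h; first by case: t' h.
move/rotationP: h => h; inversion_clear h as [a b c|? l' ? h'|? ? r' h'] => /=.
- rewrite -catA /= !leq_vec_cat // !leq_vec_cons leq_vec_cat //.
  rewrite leq_vec_cons !leq_vec_refl !sumn_cat /= !sumn_cat /=; split; lia.
- have [h1 h2] := IHl _ h'; rewrite leq_vec_cat; last first.
    by rewrite !size_bracket (rotation_nodes h').
  rewrite h1 leq_vec_cons leqnn leq_vec_refl !sumn_cat /=; split; lia.
- have [h1 h2] := IHr _ h'; rewrite leq_vec_cat // leq_vec_refl leq_vec_cons.
  by rewrite h1 (rotation_nodes h') leqnn !sumn_cat /=; split; lia.
Qed.

Lemma rotation_bracketE t t' : rotation t t' ->
  exists u m w b c, [/\ size m = b, bracket t = u ++ b :: m ++ c :: w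
                      & bracket t' = u ++ (b + c).+1 :: m ++ c :: w].
Proof.
elim: t t' => [|l IHl r IHr] t' h; first by case: t' h.
move/rotationP: h => h; inversion_clear h as [a b c|? l' ? h'|? ? r' h'] => /=.
- exists (bracket a), (bracket b), (bracket r), (nodes b), (nodes r).
  by rewrite size_bracket -catA.
- have [u [m [w [b [c [mb -> ->]]]]]] := IHl _ h'.
  exists u, m, (w ++ nodes r :: bracket r), b, c.
  by rewrite -!catA /= -!catA.
- have [u [m [w [b [c [mb -> ->]]]]]] := IHr _ h'.
  exists (bracket l ++ nodes r :: u), m, w, b, c.
  by rewrite (rotation_nodes h') -!catA.
Qed.

Lemma rotations_bracket t t' :
  rotations t t' -> leq_vec (bracket t) (bracket t').
Proof.
elim=> [|u v _ tu /rotation_bracket[uv _]]; first exact: leq_vec_refl.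
exact: leq_vec_trans tu uv.
Qed.

Lemma rotations_sumn t t' :
  rotations t t' -> t = t' \/ sumn (bracket t) < sumn (bracket t').
Proof.
elim=> [|u v _ tu /rotation_bracket[_ uv]]; first by left.
by right; case: tu => [->//|tu]; exact: ltn_trans tu uv.
Qed.

(* A node that lies in no right subtree can be rotated up to the root. *)
Lemma rotations_to_root t p : p < nodes t ->
    (forall i, i < p -> i + nth 0 (bracket t) i < p) ->
  exists l r x, [/\ nodes l = p, rotations t (Node l r)
                  & bracket t = bracket l ++ x :: bracket r].
Proof.
elim: t p => // l IHl r _ p pt lep.
case: (ltngtP p (nodes l)) => [pl|lp|->]; last first.
- by exists l, r, (nodes r); split=> //; exact: rotations_refl.
- have := lep _ lp; rewrite nth_bracket_Node ltnn eqxx; move: pt => /=; lia.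
have [|l1 [r1 [x [lE ll bE]]]] := IHl p pl.
  move=> i ip; have := lep i ip; rewrite nth_bracket_Node.
  by have ->: i < nodes l by lia.
exists l1, (Node r1 r), x; split=> //; last by rewrite /= bE -catA.
apply: rotations_step (rotation_root l1 r1 r).
by apply: rotations_Node => //; exact: rotations_refl.
Qed.

Lemma bracket_rotations t t' : nodes t = nodes t' ->
  leq_vec (bracket t) (bracket t') -> rotations t t'.
Proof.
elim: t' t => [|l' IHl r' IHr] t.
  by case: t => // _ _; exact: rotations_refl.
move=> nE le_tt'.
have sE : size (bracket t) = size (bracket (Node l' r')) by rewrite !size_bracket.
have [||l [r [x [lE tlr bE]]]] := @rotations_to_root t (nodes l').
- by rewrite nE /=; lia.
- move=> i il.
  have /(_ i) := elimT (leq_vecP sE) le_tt'.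
  rewrite nth_bracket_Node il size_bracket nE /= => le_i.
  by have [] := @bracketP l' i; rewrite size_bracket //; lia.
apply: (rotations_trans tlr); move: le_tt'.
rewrite bE /= leq_vec_cat ?size_bracket // leq_vec_cons => /and3P[hl _ hr].
have := rotations_nodes tlr; rewrite nE /= => nlr.
apply: rotations_Node; [exact: IHl|apply: IHr => //; lia].
Qed.

Fixpoint mirror t := if t is Node l r then Node (mirror r) (mirror l) else Leaf.

Lemma mirrorK : involutive mirror.
Proof. by elim=> //= l -> r ->. Qed.

Lemma nodes_mirror t : nodes (mirror t) = nodes t.
Proof. by elim: t => //= l -> r ->; rewrite addnC. Qed.

Lemma rotation_mirror t t' : rotation t t' -> rotation (mirror t') (mirror t).
Proof.
elim: t t' => [|l IHl r IHr] t' h; first by case: t' h.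
move/rotationP: h => h; inversion_clear h as [a b c|? l' ? h'|? ? r' h'].
- exact: rotation_root.
- by apply: rotation_right; exact: IHl.
- by apply: rotation_left; exact: IHr.
Qed.

Record tamari (n : nat) :=
  Tamari { tree_of :> bintree; _ : nodes tree_of == n }.

HB.instance Definition _ n := [isSub for @tree_of n].
HB.instance Definition _ n := [Countable of tamari n by <:].

(* All the binary trees of height at most [h]. *)
Fixpoint bintrees h : seq bintree :=
  if h is h'.+1
  then Leaf :: [seq Node l r | l <- bintrees h', r <- bintrees h'] else [:: Leaf].

Lemma mem_bintrees h t : nodes t <= h -> t \in bintrees h.
Proof.
elim: h t => [|h IH] [|l r] //= lrh; rewrite inE; apply/orP; right.
by apply/allpairsP; exists (l, r); split=> //=; apply: IH; lia.
Qed.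

Definition tamari_enum n : seq (tamari n) := undup (pmap insub (bintrees n)).

Lemma tamari_enumP n : Finite.axiom (tamari_enum n).
Proof.
apply: Finite.uniq_enumP => [|[t tn]]; first exact: undup_uniq.
rewrite mem_undup mem_pmap_sub /=; apply: mem_bintrees.
by rewrite (eqP tn).
Qed.

HB.instance Definition _ n := isFinite.Build (tamari n) (@tamari_enumP n).

Fact tamari_display : Order.disp_t. Proof. exact: Order.Disp tt tt. Qed.

Section TamariLattice.
Variable n : nat.
Implicit Types (t u v : tamari n).

Lemma nodes_tamari t : nodes t = n.
Proof. by case: t => t /= /eqP. Qed.

Definition tamari_rotation : rel (tamari n) := fun t t' => rotation t t'.

Definition tamari_le : rel (tamari n) := connect tamari_rotation.

Lemma tamari_le_rotations t t' : reflect (rotations t t') (tamari_le t t').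
Proof.
apply: (iffP idP) => [/connectP[p tp ->]|].
  elim/last_ind: p tp => [_|p u IH]; first exact: rotations_refl.
  by rewrite rcons_path last_rcons => /andP[/IH]; exact: rotations_step.
suff h x : rotations t x -> forall xn : nodes x == n, tamari_le t (Tamari xn).
  by case: t' => x xn /= /h.
elim=> [xn|u v tu IH uv vn].
  by have ->: Tamari xn = t; [exact: val_inj|exact: connect0].
have un : nodes u == n by rewrite (rotations_nodes tu) nodes_tamari.
exact: connect_trans (IH un) (connect1 _).
Qed.

Lemma tamari_le_bracket t t' : tamari_le t t' = leq_vec (bracket t) (bracket t').
Proof.
apply/tamari_le_rotations/idP => [/rotations_bracket //|].
by apply: bracket_rotations; rewrite !nodes_tamari.
Qed.

Lemma tamari_le_refl : reflexive tamari_le.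
Proof. exact: connect0. Qed.

Lemma tamari_le_trans : transitive tamari_le.
Proof. exact: connect_trans. Qed.

Lemma tamari_le_anti : antisymmetric tamari_le.
Proof.
move=> t t' /andP[/tamari_le_rotations/rotations_sumn tt'].
move=> /tamari_le_rotations/rotations_sumn t't; apply: val_inj => /=.
by case: tt' t't => [//|lt1] [//|lt2]; have := ltn_trans lt1 lt2; rewrite ltnn.
Qed.

HB.instance Definition _ := Order.Le_isPOrder.Build tamari_display (tamari n)
  tamari_le_refl tamari_le_anti tamari_le_trans.

Lemma tamari_meet_subproof t t' :
  exists m : tamari n,
    [forall i : 'I_n, nth 0 (bracket m) i ==
                      minn (nth 0 (bracket t) i) (nth 0 (bracket t') i)].
Proof.
pose f i := minn (nth 0 (bracket t) i) (nth 0 (bracket t') i).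
have [|m mE] := @is_bracketP (mkseq f n).
  move=> i; rewrite size_mkseq => ltin; rewrite nth_mkseq // /f.
  have [] := @bracketP t i; first by rewrite size_bracket nodes_tamari.
  have [] := @bracketP t' i; first by rewrite size_bracket nodes_tamari.
  rewrite !size_bracket !nodes_tamari => h1 h2 h3 h4; split; first lia.
  move=> j ij; rewrite nth_mkseq; last lia.
  by have := h2 j; have := h4 j; rewrite /f; lia.
have mn : nodes m == n by rewrite -size_bracket mE size_mkseq.
exists (Tamari mn); apply/forallP => i; apply/eqP.
by rewrite [tree_of _]/= mE nth_mkseq.
Qed.

Definition tamari_meet t t' : tamari n := xchoose (tamari_meet_subproof t t').

Lemma tamari_meetP u t t' :
  tamari_le u (tamari_meet t t') = tamari_le u t && tamari_le u t'.
Proof.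
have sz (x y : tamari n) : size (bracket x) = size (bracket y).
  by rewrite !size_bracket !nodes_tamari.
have mE i : i < n -> nth 0 (bracket (tamari_meet t t')) i =
    minn (nth 0 (bracket t) i) (nth 0 (bracket t') i).
  move=> lin.
  by have /forallP/(_ (Ordinal lin))/eqP := xchooseP (tamari_meet_subproof t t').
rewrite !tamari_le_bracket.
have sn : size (bracket u) = n by rewrite size_bracket nodes_tamari.
have P v : reflect (forall i, i < n -> nth 0 (bracket u) i <= nth 0 (bracket v) i)
    (leq_vec (bracket u) (bracket (v : tamari n))).
  by have := leq_vecP (sz u v); rewrite sn.
apply/P/andP => [h|[/P h1 /P h2] i ltin].
  by split; apply/P => i ltin; have := h i ltin; rewrite mE // leq_min => /andP[].
by rewrite mE // leq_min h1 // h2.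
Qed.

Fact tamari_mirror_subproof t : nodes (mirror t) == n.
Proof. by rewrite nodes_mirror nodes_tamari. Qed.

Definition tamari_mirror t : tamari n := Tamari (tamari_mirror_subproof t).

Lemma tamari_mirrorK : involutive tamari_mirror.
Proof. by move=> t; apply: val_inj; exact: mirrorK. Qed.

Lemma tamari_mirror_le t t' :
  tamari_le (tamari_mirror t) (tamari_mirror t') = tamari_le t' t.
Proof.
suff h u v : tamari_le u v -> tamari_le (tamari_mirror v) (tamari_mirror u).
  by apply/idP/idP => /h //; rewrite !tamari_mirrorK.
case/connectP=> p; elim: p u => [|w p IH] u /= => [_ ->|/andP[uw wp] vE].
  exact: tamari_le_refl.
apply: tamari_le_trans (IH w wp vE) (connect1 _).
exact: rotation_mirror.
Qed.

Definition tamari_join t t' : tamari n :=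
  tamari_mirror (tamari_meet (tamari_mirror t) (tamari_mirror t')).

Lemma tamari_joinP t t' u :
  tamari_le (tamari_join t t') u = tamari_le t u && tamari_le t' u.
Proof.
by rewrite -tamari_mirror_le tamari_mirrorK tamari_meetP !tamari_mirror_le.
Qed.

HB.instance Definition _ :=
  @Order.POrder_isMeetSemilattice.Build tamari_display (tamari n)
    tamari_meet tamari_meetP.
HB.instance Definition _ :=
  @Order.POrder_isJoinSemilattice.Build tamari_display (tamari n)
    tamari_join tamari_joinP.

Definition left_comb : bintree := iter n (Node^~ Leaf) Leaf.

Fact tamari_bot_subproof : nodes left_comb == n.
Proof. by apply/eqP; rewrite /left_comb; elim: n => //= k ->; rewrite addn0. Qed.

Definition tamari_bot : tamari n := Tamari tamari_bot_subproof.

Lemma tamari_le0 t : tamari_le tamari_bot t.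
Proof.
rewrite tamari_le_bracket.
have sz : size (bracket tamari_bot) = size (bracket t).
  by rewrite !size_bracket !nodes_tamari.
apply/leq_vecP => // i _.
have -> : bracket tamari_bot = nseq n 0.
  rewrite /= /left_comb; elim: n => //= k ->.
  by rewrite -[[:: 0]]/(nseq 1 0) -nseqD addn1.
by rewrite nth_nseq if_same.
Qed.

HB.instance Definition _ :=
  @Order.hasBottom.Build tamari_display (tamari n) tamari_bot tamari_le0.

Lemma tamari_le1 t : tamari_le t (tamari_mirror tamari_bot).
Proof. by rewrite -[t]tamari_mirrorK tamari_mirror_le tamari_le0. Qed.

HB.instance Definition _ :=
  @Order.hasTop.Build tamari_display (tamari n) _ tamari_le1.

Lemma covers_rotation t t' : covers t' t = rotation t t'.
Proof.
apply/andP/idP => [[]|tt'].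
  rewrite lt_neqAle => /andP[ne /connectP[[|u p] /= tp t'E]].
    by rewrite t'E eqxx in ne.
  move: tp => /andP[tu up]; have le_ut' : (u <= t')%O by apply/connectP; exists p.
  move/existsPn/(_ u); rewrite !lt_neqAle le_ut' andbT.
  have -> : (t <= u)%O by exact: connect1.
  have -> : t != u.
    by apply/eqP => E; move: (rotation_bracket tu); rewrite E ltnn => -[].
  by rewrite andbT /= negbK => /eqP <-.
have [le_tt' lt_tt'] := rotation_bracket tt'.
split.
  rewrite lt_neqAle; apply/andP; split; last exact: connect1.
  by apply/eqP => E; move: lt_tt'; rewrite E ltnn.
apply/existsPn => z; apply/negP => /andP[tz zt'].
have nbr (x : tamari n) : size (bracket x) = n by rewrite size_bracket nodes_tamari.
have leP (x y : tamari n) : (x <= y)%O ->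
    forall i, i < n -> nth 0 (bracket x) i <= nth 0 (bracket y) i.
  move=> xy; have /leq_vecP : leq_vec (bracket x) (bracket y).
    by rewrite -tamari_le_bracket.
  by rewrite !nbr; apply.
have [u [m [w [b [c [mb tE t'E]]]]]] := rotation_bracketE tt'.
have nE : n = (size u + (b + (size w).+1).+1) by rewrite -(nbr t) tE -mb size_cat /= size_cat.
have Eoff i : i != size u -> nth 0 (bracket t') i = nth 0 (bracket t) i.
  move=> iu; rewrite tE t'E !nth_cat; case: ltnP => // ui.
  by have -> : i - size u = (i - (size u).+1).+1 by lia.
have tp : nth 0 (bracket t) (size u) = b by rewrite tE nth_cat ltnn subnn.
have t'p : nth 0 (bracket t') (size u) = (b + c).+1.
  by rewrite t'E nth_cat ltnn subnn.
have t'q : nth 0 (bracket t) (size u + b.+1) = c.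
  by rewrite tE nth_cat ifN ?addKn /= -?mb ?nth_cat ?ltnn ?subnn //; lia.
have zoff i : i < n -> i != size u -> nth 0 (bracket z) i = nth 0 (bracket t) i.
  move=> ltin /Eoff Ei; have := leP _ _ (ltW tz) _ ltin.
  by have := leP _ _ (ltW zt') _ ltin; lia.
have pn : size u < n by lia.
have := leP _ _ (ltW tz) _ pn; have := leP _ _ (ltW zt') _ pn.
rewrite tp t'p => zle lez.
have leI (x y : tamari n) :
    (forall i, i < n -> nth 0 (bracket x) i <= nth 0 (bracket y) i) -> (x <= y)%O.
  move=> h; rewrite /Order.le /= tamari_le_bracket.
  by apply/leq_vecP; rewrite !nbr.
case: (ltnP b (nth 0 (bracket z) (size u))) => [ltz|gez].
  have [|_ /(_ (size u + b.+1))] := @bracketP z (size u); first by rewrite nbr.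
  have -> : nth 0 (bracket z) (size u + b.+1) = c.
    by rewrite zoff ?t'q //; [rewrite nE ltn_add2l ltnS|]; lia.
  move=> h.
  suff le_t'z : (t' <= z)%O by have := lt_le_trans zt' le_t'z; rewrite ltxx.
  apply: leI => i ltin; case: (eqVneq i (size u)) => [->|ne].
    by rewrite t'p; lia.
  by rewrite Eoff // zoff.
suff le_zt : (z <= t)%O by have := lt_le_trans tz le_zt; rewrite ltxx.
apply: leI => i ltin; case: (eqVneq i (size u)) => [->|ne]; first by rewrite tp.
by rewrite zoff.
Qed.

End TamariLattice.

Section TamariIntervals.
Local Open Scope order_scope.
Variable n : nat.
Implicit Types S T : tamari n.

Definition des T : nat := #|[set S | covers T S]|.
Definition asc T : nat := #|[set S | covers S T]|.

Definition tamari_intervals (k : nat) : nat :=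
  #|[set I : tamari n * tamari n | (I.1 <= I.2) && (des I.1 + asc I.2 == k)%N]|.

End TamariIntervals.

(* Main.v *)
Require Import Defs.
From mathcomp Require Import all_boot all_order.
From mathcomp Require Import zify.

Set Implicit Arguments.
Unset Strict Implicit.
Unset Printing Implicit Defensive.

Import Order.TTheory.

(** In a finite semidistributive lattice, every x has exactly one canonical
    join representation, and its size is the number of lower covers of x;
    dually for meets.  A face J + M of the canonical complex therefore comes
    from exactly one interval x <= y, with x the join of J and y the meet of M,
    and its size is the number of lower covers of x plus the number of upper
    covers of y ([card_faces]).  Applied to the Tamari lattice this identifies
    each entry of the f-vector with the corresponding number of intervals.

    The representation is explicit: with each lower cover c of x is associated
    the least element among those below x but not below c ([joinand]).  Such a
    least element exists because the elements below x and not below c are closed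
    under meets, which is the form in which join semidistributivity is used
    ([lower_covers_prime]).  In the Tamari lattice this property can be read off
    the bracket vectors: meets are componentwise minima, and t and its lower
    cover s differ in a single entry, so that below t, being below s is a bound
    on this one entry ([lower_cover_entry]).  The mirror symmetry of trees
    exchanges the order with its opposite and yields the dual property.

    It remains to see that the largest faces have n - 1 elements.  The number
    of lower covers of t is the number of its right edges, that is, of nonzero
    entries of its bracket vector, hence it is monotone in t ([des_le]); the
    number of upper covers is the number of left edges.  A tree with n nodes has
    n - 1 edges, so des s + asc t <= des t + asc t = n - 1 when s <= t, with
    equality when s = t. *)

(** * Canonical join representations from lower covers *)

Section LowerCovers.
Local Open Scope order_scope.
Context {disp : Order.disp_t} {L : finTBLatticeType disp}.
Implicit Types (x y c : L) (J : {set L}).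

Definition lower_covers x : {set L} := [set c | covers x c].

Lemma covers_lt x c : covers x c -> c < x.
Proof. by case/andP. Qed.

Lemma covers_eq x c z : covers x c -> c <= z -> z < x -> z = c.
Proof.
case/andP=> _ /existsPn/(_ z); rewrite lt_neqAle => h cz zx.
by move: h; rewrite cz zx !andbT negbK => /eqP.
Qed.

(** A maximal element of the interval between z and x, x excluded, is a lower
    cover of x. *)
Lemma lt_lower_cover z x : z < x -> exists2 c, covers x c & z <= c.
Proof.
(* Few elements above means high up, so minimizing this number gives a
   maximal element. *)
move=> zx; pose above (u : L) := #|[set v | u <= v]|.
have zP : (z <= z) && (z < x) by rewrite lexx.
case: (@arg_minnP _ z [pred u | z <= u < x] above zP) => c /andP[zc cx] cmin.
exists c => //.
rewrite /covers cx /=; apply/existsPn => w; apply/negP => /andP[cw wx].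
have := cmin w; rewrite /= wx (le_trans zc (ltW cw)) => /(_ isT).
rewrite leqNgt => /negP[]; apply: proper_card.
apply/properP; split.
  by apply/subsetP => v; rewrite !inE; exact: le_trans (ltW cw).
by exists c; rewrite !inE ?lexx // lt_geF.
Qed.

(** For finite lattices this is equivalent to join semidistributivity: an
    element y <= x lies below the lower cover c exactly when the join of y and c
    is not x, so the property says that c `|` y = c `|` z = x forces
    c `|` (y `&` z) = x. *)
Definition lower_covers_prime : Prop :=
  forall x c y z, covers x c -> y <= x -> z <= x ->
    y `&` z <= c -> (y <= c) || (z <= c).

Definition joinand x c : L := \meet_(j | (j <= x) && ~~ (j <= c)) j.

Definition joinands x : {set L} := joinand x @: lower_covers x.

(** If i < j both belong to J, then i can be removed without changing the
    join. *)
Lemma irredundant_join_antichain J x : irredundant_join_rep J x ->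
  {in J &, forall i j, i <= j -> i = j}.
Proof.
case/andP=> /eqP Jx /forallP irr i j iJ jJ ij; apply/eqP/negPn/negP => ne.
have /implyP/(_ (properD1 iJ))/negP[] := irr (J :\ i).
rewrite -Jx eq_le; apply/andP; split.
  apply/joinsP => k; rewrite !inE => /andP[_ kJ]; exact: (joins_sup id).
apply/joinsP => k kJ; case: (eqVneq k i) => [->|ki].
  by apply: le_trans ij _; apply: (joins_sup id); rewrite !inE eq_sym ne.
by apply: (joins_sup id); rewrite !inE ki.
Qed.

Lemma joinand_min x c y : y <= x -> ~~ (y <= c) -> joinand x c <= y.
Proof. by move=> yx yc; apply: (meets_inf id); rewrite yx. Qed.

Lemma joinand_le x c : covers x c -> joinand x c <= x.
Proof. by move=> /covers_lt xc; apply: joinand_min; rewrite // lt_geF. Qed.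

(** Distinct lower covers of x are incomparable, so c' is one of the elements
    whose meet is [joinand x c]. *)
Lemma joinand_le_other x c c' :
  covers x c -> covers x c' -> c != c' -> joinand x c <= c'.
Proof.
move=> xc xc' ne; apply: joinand_min; first exact/ltW/covers_lt.
apply: contra ne => c'c; apply/eqP.
exact: covers_eq xc' c'c (covers_lt xc).
Qed.

Hypothesis prime : lower_covers_prime.

(** The meet defining the joinand is itself one of the elements it ranges over,
    because those are closed under binary meets. *)
Lemma joinand_not_le x c : covers x c -> ~~ (joinand x c <= c).
Proof.
move=> xc; rewrite -(meet_idPl (joinand_le xc)) meetC.
(* Meeting with x makes the property true of the top element, the value of
   the empty meet, which does not lie below x in general. *)
apply: (big_ind (fun m => ~~ (x `&` m <= c))).
- by rewrite meetx1 lt_geF ?covers_lt.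
- move=> m m' mc m'c; apply/negP => le_c.
  have := @prime x c (x `&` m) (x `&` m') xc; rewrite !leIl.
  rewrite (negPf mc) (negPf m'c) => /(_ isT isT) h.
  by suff : false by []; apply: h; rewrite meetACA meetxx.
- by move=> j /andP[jx jc]; rewrite meetC (meet_idPl jx).
Qed.

Lemma joinand_inj x : {in lower_covers x &, injective (joinand x)}.
Proof.
move=> c c'; rewrite !inE => xc xc' E; apply/eqP/negPn/negP => ne.
by have := joinand_le_other xc xc' ne; rewrite E (negPf (joinand_not_le xc')).
Qed.

Lemma card_joinands x : #|joinands x| = #|lower_covers x|.
Proof. exact: card_in_imset (@joinand_inj x). Qed.

(** Were the join smaller than x, it would lie below some lower cover c, and so
    would the joinand attached to c. *)
Lemma joinands_join x : \join_(j in joinands x) j = x.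
Proof.
have jx : \join_(j in joinands x) j <= x.
  by apply/joinsP => _ /imsetP[c + ->]; rewrite inE; exact: joinand_le.
apply/eqP/negPn/negP => ne.
have [|c xc jc] := @lt_lower_cover (\join_(j in joinands x) j) x.
  by rewrite lt_neqAle ne.
case/negP: (joinand_not_le xc); apply: le_trans jc.
by apply: (joins_sup id); apply: imset_f; rewrite inE.
Qed.

(** Without the joinand of c, all remaining joinands lie below c. *)
Lemma joinands_irredundant x : irredundant_join_rep (joinands x) x.
Proof.
rewrite /irredundant_join_rep joinands_join eqxx /=.
apply/forallP => J; apply/implyP => /properP[/subsetP sub].
move=> [_ /imsetP[c + ->] cJ]; rewrite inE => xc.
suff /le_lt_trans/(_ (covers_lt xc)) : \join_(j in J) j <= c.
  by move/lt_eqF->.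
apply/joinsP => j jJ; have /imsetP[c' + jE] := sub j jJ; rewrite inE => xc'.
rewrite jE; apply: joinand_le_other => //; apply/eqP => E.
by case/negP: cJ; rewrite -E -jE.
Qed.

(** For each lower cover c of x, some member of J is not below c; it lies below
    x, hence above the joinand of c. *)
Lemma joinands_refine J x :
  \join_(j in J) j = x -> join_refines (joinands x) J.
Proof.
move=> Jx; apply/forallP => i; apply/implyP => /imsetP[c + ->].
rewrite inE => xc; apply/existsP.
have : ~~ [forall j in J, j <= c].
  apply/negP => /forallP h; have := covers_lt xc; rewrite lt_leAnge andbC.
  by case/andP=> /negP[]; rewrite -Jx; apply/joinsP => j; exact/implyP.
rewrite negb_forall => /existsP[j]; rewrite negb_imply => /andP[jJ jc].
exists j; rewrite jJ; apply: joinand_min jc.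
by rewrite -Jx; exact: (joins_sup id).
Qed.

(** Uniqueness: two irredundant representations that refine each other have
    the same members, since i <= k <= j with i, j in an antichain forces
    i = k = j. *)
Lemma canonical_join_repE J x : canonical_join_rep J x = (J == joinands x).
Proof.
apply/andP/eqP => [[Jirr Jmin]|->]; last first.
  split; first exact: joinands_irredundant.
  by apply/forallP=> J'; apply/implyP=> /andP[/eqP ? _]; exact: joinands_refine.
have [/eqP Jx _] := andP Jirr.
have sub : J \subset joinands x.
  apply/subsetP => i iJ.
  have /forallP/(_ (joinands x))/implyP/(_ (joinands_irredundant x)) := Jmin.
  move/forallP/(_ i)/implyP/(_ iJ)/existsP => [k /andP[kc ik]].
  have /forallP/(_ k)/implyP/(_ kc)/existsP[j /andP[jJ kj]] := joinands_refine Jx.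
  have ijE := irredundant_join_antichain Jirr iJ jJ (le_trans ik kj).
  suff -> : i = k by [].
  by apply/eqP; rewrite eq_le ik ijE kj.
have /andP[_ /forallP/(_ J)] := joinands_irredundant x.
rewrite Jx eqxx implybF properE sub /= negbK => le_J.
by apply/eqP; rewrite eqEsubset sub.
Qed.

End LowerCovers.

(** * Faces of the canonical complex and intervals *)

Lemma covers_dual {disp : Order.disp_t} {L : finTBLatticeType disp} (x y : L) :
  covers (L := L^d) x y = covers y x.
Proof.
by rewrite /covers; congr (_ && ~~ _); apply: eq_existsb => z; rewrite andbC.
Qed.

Section Faces.
Local Open Scope order_scope.
Context {disp : Order.disp_t} {L : finTBLatticeType disp}.
Implicit Types (x y : L) (J M : {set L}) (I : L * L).

Lemma card_disjoint_union J M : #|disjoint_union J M| = (#|J| + #|M|)%N.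
Proof.
rewrite cardsU !card_imset; [|by move=> ? ? []..].
rewrite (_ : _ :&: _ = set0) ?cards0 ?subn0 //; apply/setP => v.
by rewrite !inE; apply/andP => -[/imsetP[j _ ->] /imsetP[]].
Qed.

Lemma disjoint_union_inj J M J' M' :
  disjoint_union J M = disjoint_union J' M' -> J = J' /\ M = M'.
Proof.
move/setP => E; split; apply/setP => v; [have := E (inl v)|have := E (inr v)].
- rewrite !inE !mem_imset; [|by move=> ? ? []..].
  have inr0 (A : {set L}) : inl v \in [set inr m | m in A] = false :> bool.
    by apply/imsetP => -[].
  by rewrite !inr0 !orbF.
- rewrite !inE !mem_imset; [|by move=> ? ? []..].
  have inl0 (A : {set L}) : inr v \in [set inl m | m in A] = false :> bool.
    by apply/imsetP => -[].
  by rewrite !inl0.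
Qed.

Definition upper_covers y : {set L} := [set c | covers c y].

Definition meetands y : {set L} := joinands (L := L^d) y.

Definition face I := disjoint_union (joinands I.1) (meetands I.2).

Hypothesis prime : lower_covers_prime (L := L).
Hypothesis dual_prime : lower_covers_prime (L := L^d).

Lemma card_meetands y : #|meetands y| = #|upper_covers y|.
Proof.
have -> : #|meetands y| = #|lower_covers (L := L^d) y|.
  exact: (card_joinands dual_prime y).
by apply: eq_card => c; rewrite !inE covers_dual.
Qed.

Lemma meetands_meet y : \meet_(m in meetands y) m = y.
Proof. exact: (joinands_join dual_prime y). Qed.

(** Canonical meet representations are, by definition, canonical join
    representations in the dual lattice. *)
Lemma canonical_meet_repE M y : canonical_meet_rep M y = (M == meetands y).
Proof. exact: (canonical_join_repE dual_prime M y). Qed.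

(** The two ends of the interval are recovered as the join of the members of
    one kind and the meet of the members of the other. *)
Lemma face_inj : injective face.
Proof.
move=> [x y] [x' y'] /disjoint_union_inj[/= Ex Ey]; congr pair.
  by rewrite -(joinands_join prime x) Ex joinands_join.
by rewrite -(meetands_meet y) Ey meetands_meet.
Qed.

Lemma card_face I : #|face I| = (#|lower_covers I.1| + #|upper_covers I.2|)%N.
Proof. by rewrite card_disjoint_union card_joinands // card_meetands. Qed.

Lemma canonical_complexE :
  canonical_complex L = face @: [set I : L * L | I.1 <= I.2].
Proof.
apply/setP => F; rewrite inE; apply/idP/imsetP => [|[[x y]]].
  case/existsP=> x /existsP[y] /existsP[J] /existsP[M].
  rewrite canonical_join_repE // canonical_meet_repE.
  by case/and4P=> xy /eqP-> /eqP-> /eqP->; exists (x, y); rewrite ?inE.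
rewrite inE /= => xy ->; apply/existsP; exists x; apply/existsP; exists y.
apply/existsP; exists (joinands x); apply/existsP; exists (meetands y).
by rewrite xy canonical_join_repE // canonical_meet_repE !eqxx.
Qed.

Lemma card_faces k :
  #|[set F in canonical_complex L | #|F| == k]| =
  #|[set I : L * L | (I.1 <= I.2) &&
      (#|lower_covers I.1| + #|upper_covers I.2| == k)%N]|.
Proof.
rewrite -(card_imset _ face_inj); apply: eq_card => F.
rewrite inE canonical_complexE; apply/andP/imsetP.
  case=> /imsetP[I + ->]; rewrite inE card_face => leI cI.
  by exists I; rewrite // inE leI.
case=> I; rewrite inE => /andP[leI cI] ->; rewrite card_face cI; split=> //.
by apply: imset_f; rewrite inE.
Qed.

End Faces.

(** * Semidistributivity of the Tamari lattice *)

Section TamariSemidistributive.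
Local Open Scope order_scope.
Variable n : nat.
Implicit Types x y z s t : tamari n.

Lemma size_bracket_tamari t : size (bracket t) = n.
Proof. by rewrite size_bracket nodes_tamari. Qed.

(** The index is unbounded, the entries beyond the last one being 0 on both
    sides. *)
Lemma tamari_leP x y :
  reflect (forall i, (nth 0 (bracket x) i <= nth 0 (bracket y) i)%N) (x <= y).
Proof.
have szE : size (bracket x) = size (bracket y) by rewrite !size_bracket_tamari.
rewrite [x <= y]tamari_le_bracket; apply: (iffP (leq_vecP szE)) => h i //.
have [|ge_i] := ltnP i (size (bracket x)); first exact: h.
by rewrite nth_default.
Qed.

Lemma nth_tamari_meet x y i :
  nth 0 (bracket (x `&` y)) i =
  minn (nth 0 (bracket x) i) (nth 0 (bracket y) i).
Proof.
have [lt_in|le_ni] := ltnP i n; last by rewrite !nth_default ?size_bracket_tamari.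
exact/eqP/(forallP (xchooseP (tamari_meet_subproof x y)) (Ordinal lt_in)).
Qed.

(** The vectors of s and t differ in one entry only, which is b in s; at all
    other entries x <= t already gives what x <= s requires. *)
Lemma lower_cover_entry t s : covers t s ->
  exists i b, forall x, x <= t -> (x <= s) = (nth 0 (bracket x) i <= b)%N.
Proof.
rewrite covers_rotation => /rotation_bracketE.
case=> u [m [w [b [c [_ sE tE]]]]]; exists (size u), b => x /tamari_leP xt.
apply/tamari_leP/idP => [/(_ (size u))|xb i].
  by rewrite sE nth_cat ltnn subnn.
have := xt i; rewrite sE tE !nth_cat; case: ltnP => // le_ui.
have [->|ne] := eqVneq i (size u); first by rewrite subnn.
by have -> : i - size u = (i - (size u).+1).+1 :> nat by lia.
Qed.

(** An entry of the meet is the minimum of the two entries, and a minimum is at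
    most b only if one of its arguments is. *)
Lemma tamari_lower_covers_prime : lower_covers_prime (L := tamari n).
Proof.
move=> t s y z /lower_cover_entry[i [b E]] yt zt; rewrite !E ?leIxl //.
by rewrite nth_tamari_meet geq_min.
Qed.

Lemma tamari_covers_mirror s t :
  covers (tamari_mirror s) (tamari_mirror t) = covers t s.
Proof.
suff h (u v : tamari n) : covers u v -> covers (tamari_mirror v) (tamari_mirror u).
  by apply/idP/idP => /h //; rewrite !tamari_mirrorK.
by rewrite !covers_rotation; exact: rotation_mirror.
Qed.

Lemma tamari_dual_lower_covers_prime : lower_covers_prime (L := (tamari n)^d).
Proof.
move=> t s y z; rewrite covers_dual -tamari_covers_mirror => ts ty tz yz.
have mle := @tamari_mirror_le n.
have := @tamari_lower_covers_prime _ _ (tamari_mirror y) (tamari_mirror z) ts.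
rewrite ![tamari_mirror _ <= _]mle; apply => //.
move: yz; rewrite -[y `&` z <= s](mle (tamari_join y z : tamari n) s).
by rewrite tamari_mirrorK.
Qed.

End TamariSemidistributive.

(** * Counting covers in the Tamari lattice *)

(** The trees from which t is obtained by one right rotation, one for each
    right edge of t. *)
Fixpoint lower_rotations t : seq bintree :=
  if t is Node l r then
    (if r is Node b c then [:: Node (Node l b) c] else [::]) ++
    [seq Node l' r | l' <- lower_rotations l] ++
    [seq Node l r' | r' <- lower_rotations r]
  else [::].

Lemma mem_lower_rotations s t : (s \in lower_rotations t) = rotation s t.
Proof.
apply/idP/idP; elim: t s => [|l IHl r IHr] s //=.
- rewrite !mem_cat => /or3P[|/mapP[l' /IHl lP ->]|/mapP[r' /IHr rP ->]].
  + by case: r {IHr} => // b c; rewrite inE => /eqP ->; exact: rotation_root.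
  + exact: rotation_left.
  + exact: rotation_right.
- by case: s.
- move/rotationP; move tE: (Node l r) => t st.
  case: st tE => [a b c|l1 l2 r1 l12|l1 r1 r2 r12] [lE rE]; subst.
  + by rewrite inE eqxx.
  + by rewrite !mem_cat map_f ?orbT // IHl.
  + by rewrite !mem_cat map_f ?orbT // IHr.
Qed.

Lemma rotation_irrefl t : rotation t t = false.
Proof. by apply/negP => /rotation_bracket[_]; rewrite ltnn. Qed.

Lemma uniq_lower_rotations t : uniq (lower_rotations t).
Proof.
elim: t => [|l IHl r IHr] //=.
rewrite !cat_uniq !map_inj_uniq ?IHl ?IHr; [|by move=> ? ? []..].
rewrite has_cat negb_or -!all_predC !andbT -!andbA /=; apply/and4P; split.
- by case: r {IHr}.
- apply/allP => _ /mapP[l' + ->]; rewrite mem_lower_rotations => l'l.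
  case: r {IHr} => //= b c; rewrite inE; apply/negP => /eqP[lE _].
  by have := rotation_nodes l'l; rewrite lE /=; lia.
- apply/allP => _ /mapP[r' + ->]; rewrite mem_lower_rotations => r'r.
  case: r {IHr} r'r => //= b c _; rewrite inE; apply/negP => /eqP[lE _].
  by have := congr1 nodes lE => /=; lia.
- apply/allP => _ /mapP[r' + ->]; rewrite mem_lower_rotations => r'r.
  apply/mapP => -[l' + [lE _]].
  by rewrite mem_lower_rotations -lE rotation_irrefl.
Qed.

(** A node is the upper end of a right edge exactly when its right subtree,
    whose size is its entry of the bracket vector, is nonempty. *)
Definition right_edges t : nat := count (predC1 0) (bracket t).

Lemma size_lower_rotations t : size (lower_rotations t) = right_edges t.
Proof.
rewrite /right_edges; elim: t => [|l IHl r IHr] //=.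
rewrite !size_cat !size_map count_cat IHl IHr /=.
by case: r {IHr} => //=; lia.
Qed.

(** The right edges of the mirror image are the left edges of t, and a nonempty
    tree has one edge fewer than nodes. *)
Lemma right_edges_mirror t :
  right_edges t + right_edges (mirror t) = (nodes t).-1.
Proof.
rewrite /right_edges; elim: t => [|l IHl r IHr] //=.
rewrite !count_cat /= nodes_mirror.
(* The truncated predecessor makes the empty subtrees special cases. *)
move: IHl IHr; case: l => [|a b] /=; case: r => [|c d] /=; lia.
Qed.

Section TamariFVector.
Variable n : nat.
Implicit Types s t : tamari n.

Lemma des_right_edges t : des t = right_edges t.
Proof.
rewrite -size_lower_rotations /des cardE -(size_map val); apply: perm_size.
apply: uniq_perm.
- by rewrite map_inj_uniq ?enum_uniq //; exact: val_inj.
- exact: uniq_lower_rotations.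
move=> u; rewrite mem_lower_rotations; apply/mapP/idP => [[s + ->]|ut].
  by rewrite mem_enum inE covers_rotation.
have un : nodes u == n by rewrite -(rotation_nodes ut) nodes_tamari.
by exists (Tamari un); rewrite // mem_enum inE covers_rotation.
Qed.

Lemma asc_right_edges t : asc t = right_edges (mirror t).
Proof.
rewrite -(des_right_edges (tamari_mirror t)) /asc /des.
rewrite -(card_imset _ (inv_inj (@tamari_mirrorK n))); apply: eq_card => s.
rewrite -[s]tamari_mirrorK mem_imset ?inE ?tamari_covers_mirror //.
exact: inv_inj (@tamari_mirrorK n).
Qed.

Lemma des_asc t : des t + asc t = n.-1.
Proof.
by rewrite des_right_edges asc_right_edges right_edges_mirror nodes_tamari.
Qed.

(** A nonzero entry of the bracket vector stays nonzero when it increases. *)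
Lemma des_le s t : (s <= t)%O -> des s <= des t.
Proof.
rewrite !des_right_edges /right_edges [(s <= t)%O]tamari_le_bracket /leq_vec.
elim: (bracket s) (bracket t) => [|a u IH] [|b v] //= /andP[ab /IH].
by case: a b ab => [|a] [|b] //=; lia.
Qed.

End TamariFVector.

Theorem proposition4 (n : nat) (n_gt0 : 0 < n) :
  fvector (canonical_complex (tamari n)) = mkseq (tamari_intervals n) n.
Proof.
have prime := @tamari_lower_covers_prime n.
have dual_prime := @tamari_dual_lower_covers_prime n.
rewrite /fvector.
have -> : \max_(F in canonical_complex (tamari n)) #|F| = n.-1.
  rewrite canonical_complexE //; apply/eqP; rewrite eqn_leq; apply/andP; split.
    apply/bigmax_leqP => _ /imsetP[[s t] + ->].
    rewrite inE card_face //= => /des_le le_st.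
    by rewrite -(des_asc t) leq_add2r.
  (* Any one-element interval reaches the bound; the bottom is a choice of t. *)
  pose t := tamari_bot n.
  rewrite -(des_asc t) -(card_face prime dual_prime (t, t)).
  by apply: leq_bigmax_cond; apply: imset_f; rewrite inE.
rewrite prednK //; apply: eq_mkseq => k; exact: card_faces.
Qed.
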